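(* Let $X$ be a metric space with metric $d$, let $\mu$ be a $\sigma$-finite measure on some measurable space $(\Omega,\Sigma)$, and let $1 \le q < p < \infty$. Suppose that $T : X \to L_q(\mu)$ is a Lipschitz map and $C>0$. The following are equivalent: (a) There exists a density function $h$ on $\Omega$ such that $$\left[ \int_{\{h>0\}} \left|\frac{Tx-Tx'}{h^{1/q}}\right|^p h\,d\mu \right]^{1/p} \le C\, d(x,x') \qquad \text{for all } x,x' \in X,$$ and $$\mu\{ |Tx-Tx'| >0,\ h=0 \} = 0 \qquad \text{for all } x, x' \in X.$$ (b) For every $x_1,\dots,x_n,x_1',\dots,x_n' \in X$ and $\lambda_1,\dots,\lambda_n \ge 0$, $$\left\| \Big(\sum_{j=1}^n \lambda_j|Tx_j-Tx_j'|^p\Big)^{1/p} \right\|_{L_q(\mu)} \le C \Big(\sum_{j=1}^n \lambda_j\, d(x_j,x_j')^p\Big)^{1/p}.$$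
   Context: A density function on $\Omega$ (with respect to $\mu$) is a measurable function $h:\Omega\to[0,\infty)$ with $\int_\Omega h\,d\mu = 1$. Functions are real valued. In (b), $n$ is an arbitrary positive integer.
   Formalization: The measure μ is assumed to be nonzero (μ(Ω) ≠ 0): for the zero measure no density function exists, so (a) fails, while (b) holds trivially, and the equivalence as stated is false in that case. *)

(* Defs.v *)
From HB Require Import structures.
From mathcomp Require Import all_boot all_order all_algebra.
From mathcomp Require Import all_classical all_reals all_analysis.
Import Order.TTheory GRing.Theory Num.Theory.

Set Implicit Arguments.
Unset Strict Implicit.
Unset Printing Implicit Defensive.

Local Open Scope classical_set_scope.
Local Open Scope ring_scope.

Definition density_function (d : measure_display) (Omega : measurableType d)
    (R : realType) (mu : {measure set Omega -> \bar R}) (h : Omega -> R) : Prop :=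
  [/\ measurable_fun [set: Omega] h,
      (forall w, 0 <= h w) &
      (\int[mu]_w (h w)%:E = 1)%E].

(* Elements of [LspaceType mu q1] are classes of functions modulo equality
   mu-almost everywhere; the coercion to functions picks a representative, on
   which none of the a.e.-invariant quantities below depend.  The library puts
   no norm on this type, so the distance in L_q is written as the L_q-norm of
   the difference of representatives. *)
Definition Lspace_lipschitz (R : realType) (X : metricType R)
    (d : measure_display) (Omega : measurableType d)
    (mu : {measure set Omega -> \bar R}) (q : \bar R) (q1 : (1 <= q)%E)
    (T : X -> LspaceType mu q1) : Prop :=
  exists L : R, forall x x' : X,
    ('N[mu]_q[(fun w => (T x w - T x' w)%:E)] <= (L * mdist x x')%:E)%E.

(* Main.v *)
(* Put r = q / p < 1 and let K be the convex set of the functions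
   \sum_j lambda_j |T x_j - T x'_j| ^ p with \sum_j lambda_j (C d(x_j, x'_j)) ^ p <= 1.
   By homogeneity, (b) says that \int f ^ r <= 1 for every f in K.
   From (b) to (a): strict concavity of t ^ r makes a fast maximizing sequence of
   \int f ^ r on K converge almost everywhere to some f, and the first-order
   optimality condition passes to the limit by Fatou's lemma: for all g in K,
   \int_{f > 0} g f ^ (r - 1) <= sup_K \int f ^ r <= 1, and g = 0 a.e. on {f = 0}.
   Then h = f ^ r / \int f ^ r is the required density; no compactness or minimax
   theorem is needed.
   From (a) to (b): integrate the weighted AM-GM inequality
   f ^ r <= r k ^ (r - 1) f h ^ (1 - 1 / r) + (1 - r) k ^ r h and choose k. *)
Require Import Defs.
From HB Require Import structures.
From mathcomp Require Import all_boot all_order all_algebra.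
From mathcomp Require Import all_classical all_reals all_analysis.
From mathcomp Require Import measurable_realfun ring lra.
Import Order.TTheory GRing.Theory Num.Theory.
Import numFieldNormedType.Exports.

Local Open Scope classical_set_scope.
Local Open Scope ring_scope.

Set Implicit Arguments.
Unset Strict Implicit.

(** * Quantitative concavity of [t ^ r] on the half-line *)

Section real_inequalities.
Context {R : realType}.
Implicit Types (a b r s x : R).

(** Young's inequality for the product of [x ^ r] and [1], with conjugate exponents [1 / r] and
    [1 / (1 - r)]. *)
Lemma powR_le_affine r x : 0 <= x -> 0 < r -> r <= 1 ->
  x `^ r <= r * x + (1 - r).
Proof.
move=> x0 r0; rewrite le_eqVlt => /predU1P[->|r1]; first by rewrite powRr1//; lra.
have := @conjugate_powR _ (x `^ r) 1 r^-1 (1 - r)^-1 (powR_ge0 _ _) ler01.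
rewrite !invr_gt0 subr_gt0 !invrK => /(_ r0 r1).
rewrite -powRrM mulfV ?gt_eqF// powRr1// powR1 mulr1 mul1r.
by rewrite [r * x]mulrC; apply; ring.
Qed.

(** With [s = sqrt (1 + x)], 16 times the difference of the two sides factors as
    [(s - 1) ^ 2 (8 - (s + 1) ^ 2)], and [s <= 3 / 2] makes the second factor positive. *)
Lemma sqrt_gap x : -1 <= x -> x <= 1 ->
  Num.sqrt (1 + x) <= 1 + x / 2 - x ^+ 2 / 16.
Proof.
move=> xN1 x1; set s := Num.sqrt _.
have s0 : 0 <= s by exact: sqrtr_ge0.
have s2 : s ^+ 2 = 1 + x by rewrite sqr_sqrtr//; lra.
have -> : x = s ^+ 2 - 1 by lra.
have s32 : s <= 3 / 2 by nra.
have : 0 <= (s - 1) ^+ 2 * (8 - (s + 1) ^+ 2).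
  by apply: mulr_ge0; [exact: sqr_ge0|nra].
nra.
Qed.

(* [t `^ r] is interpolated between [Num.sqrt t] and [1] or [t], by AM-GM. *)
Lemma powR_gap r x : 0 < r < 1 -> -1 <= x -> x <= 1 ->
  (1 + x) `^ r <= 1 + r * x - r * (1 - r) / 8 * x ^+ 2.
Proof.
move=> /andP[r0 r1] xN1 x1; have := sqrt_gap xN1 x1.
set s := Num.sqrt _ => hs.
have s0 : 0 <= s by exact: sqrtr_ge0.
have s2 : s ^+ 2 = 1 + x by rewrite sqr_sqrtr//; lra.
have x2 : 0 <= x ^+ 2 by exact: sqr_ge0.
have -> : (1 + x) `^ r = s `^ (2 * r) by rewrite -s2 -powR_mulrn// -powRrM.
(* The quadratic loss obtained is [r x ^ 2 / 8] in the first case and [(1 - r) x ^ 2 / 8] in the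
   second; both are at least [r (1 - r) x ^ 2 / 8]. *)
have [r2|r2] := leP (2 * r) 1.
  have r20 : 0 < 2 * r by lra.
  have := powR_le_affine s0 r20 r2.
  have : 0 <= r * (1 + x / 2 - x ^+ 2 / 16 - s) by apply: mulr_ge0; lra.
  have : 0 <= r * r * x ^+ 2 by rewrite mulr_ge0// mulr_ge0; lra.
  lra.
have -> : s `^ (2 * r) = s * s `^ (2 * r - 1).
  by rewrite mulr_powRB1//; lra.
have r20 : 0 < 2 * r - 1 by lra.
have r21 : 2 * r - 1 <= 1 by lra.
have h := powR_le_affine s0 r20 r21.
have h2 := ler_wpM2l s0 h.
have h3 : r * s ^+ 2 = r * (1 + x) by rewrite s2.
have : 0 <= (1 - r) * (1 - r) * x ^+ 2 by rewrite mulr_ge0// mulr_ge0; lra.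
have : 0 <= (1 - r) * (1 + x / 2 - x ^+ 2 / 16 - s) by apply: mulr_ge0; lra.
lra.
Qed.

(** For [0 < s <= 1] the power [t ^ s] lies between [1] and [t]. *)
Lemma powR_dist1 s x : 0 < s <= 1 -> -1 <= x -> `|(1 + x) `^ s - 1| <= `|x|.
Proof.
move=> /andP[s0 s1] xN1; have x0 : 0 <= 1 + x by lra.
have h := powR_le_affine x0 s0 s1.
have [xge0|xlt0] := leP 0 x.
  have : 1 `^ s <= (1 + x) `^ s by apply: ge0_ler_powR; rewrite ?nnegrE; lra.
  rewrite powR1 => h1; rewrite !ger0_norm//; nra.
have h1 : (1 + x) `^ s <= 1 `^ s by apply: ge0_ler_powR; rewrite ?nnegrE; lra.
rewrite powR1 in h1.
rewrite ler0_norm ?subr_le0// ltr0_norm//.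
suff : 1 + x <= (1 + x) `^ s by lra.
move: x0; rewrite le_eqVlt => /predU1P[<-|x0]; first exact: powR_ge0.
by apply: ger1_powR => //; rewrite x0; lra.
Qed.

(** Write [a = m (1 + x)] and [b = m (1 - x)]. Averaging [powR_gap] at [x] and [-x] cancels the
    linear terms and leaves a gain [r (1 - r) / 8 * x ^ 2]. The exponent [r / 2] makes the square
    scale like [m ^ r], and [powR_dist1] bounds it by [4 x ^ 2 m ^ r], whence the constant 32. *)
Lemma powR_midpoint_gap r a b : 0 < r < 1 -> 0 <= a -> 0 <= b ->
  (a `^ r + b `^ r) / 2 + r * (1 - r) / 32 * (a `^ (r / 2) - b `^ (r / 2)) ^+ 2
  <= ((a + b) / 2) `^ r.
Proof.
move=> /andP[r0 r1] a0 b0; have [ab0|ab0] := eqVneq (a + b) 0.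
  have [-> ->] : a = 0 /\ b = 0 by lra.
  by rewrite !addr0 mul0r subrr expr0n/= mulr0 addr0 powR0 ?gt_eqF// add0r mul0r.
have abgt0 : 0 < a + b by lra.
set m := (a + b) / 2; have [x xE] : exists x, x = (a - b) / (a + b) by eexists.
have m0 : 0 <= m by rewrite /m; lra.
have aE : a = m * (1 + x) by rewrite /m xE; field.
have bE : b = m * (1 + - x) by rewrite /m xE; field.
have xN1 : -1 <= x by rewrite xE ler_pdivlMr//; lra.
have x1 : x <= 1 by rewrite xE ler_pdivrMr//; lra.
have hmul s : a `^ s = m `^ s * (1 + x) `^ s by rewrite {1}aE powRM//; lra.
have hmul' s : b `^ s = m `^ s * (1 + - x) `^ s by rewrite {1}bE powRM//; lra.
rewrite !hmul !hmul' -mulrBr exprMn.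
have -> : (m `^ (r / 2)) ^+ 2 = m `^ r.
  by rewrite -powR_mulrn ?powR_ge0// -powRrM divfK.
have r01 : 0 < r < 1 by rewrite r0.
have g1 := powR_gap r01 xN1 x1.
have g2 : (1 + - x) `^ r <= 1 + r * - x - r * (1 - r) / 8 * (- x) ^+ 2.
  by apply: powR_gap => //; lra.
have rs : 0 < r / 2 <= 1 by lra.
have d1 := powR_dist1 rs xN1.
have d2 : `|(1 + - x) `^ (r / 2) - 1| <= `|- x| by apply: powR_dist1 => //; lra.
rewrite normrN in d2.
set U := (1 + x) `^ (r / 2) in d1 *; set V := (1 - x) `^ (r / 2) in d2 *.
have d3 : (U - V) ^+ 2 <= 4 * x ^+ 2.
  have -> : 4 * x ^+ 2 = (2 * `|x|) ^+ 2 by rewrite exprMn real_normK ?num_real//; ring.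
  rewrite -[leLHS]real_normK ?num_real//; apply: lerXn2r.
  - by rewrite nnegrE.
  - by rewrite nnegrE mulr_ge0.
  have -> : U - V = (U - 1) - (V - 1) by ring.
  by rewrite (le_trans (ler_normB _ _))//; lra.
have k0 : 0 <= r * (1 - r) / 32 by nra.
have d4 := ler_wpM2l k0 d3.
have M0 : 0 <= m `^ r by exact: powR_ge0.
rewrite sqrrN in g2.
set P := (1 + x) `^ r in g1 *; set Q := (1 - x) `^ r in g2 *.
set W := (U - V) ^+ 2 in d4 *.
have : (P + Q) / 2 + r * (1 - r) / 32 * W <= 1 by lra.
move=> /(ler_wpM2l M0); rewrite mulr1; apply: le_trans.
by rewrite le_eqVlt; apply/orP; left; apply/eqP; field.
Qed.

(** The graph lies below its tangent at [b]: this is [powR_le_affine] at [a / b], multiplied by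
    [b ^ r]. *)
Lemma powR_tangent r a b : 0 < r < 1 -> 0 <= a -> a <= b ->
  a `^ r + r * (b - a) * b `^ (r - 1) <= b `^ r.
Proof.
move=> /andP[r0 r1] a0 ab; have [b0|b0] := eqVneq b 0.
  have a_0 : a = 0 by lra.
  by rewrite a_0 b0 subrr mulr0 mul0r addr0.
have bgt0 : 0 < b by lra.
have ab0 : 0 <= a / b by rewrite divr_ge0// ltW.
have := powR_le_affine ab0 r0 (ltW r1).
have -> : b `^ (r - 1) = b `^ r / b.
  by rewrite powRB ?b0 ?implybT// powRr1// ltW.
have -> : a `^ r = (a / b) `^ r * b `^ r.
  by rewrite -powRM// ?(ltW bgt0)// divfK.
move=> /(ler_wpM2r (powR_ge0 b r)) h.
have -> : r * (b - a) * (b `^ r / b) = r * (1 - a / b) * b `^ r by field.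
lra.
Qed.

End real_inequalities.

(** * Convergence of real sequences and of their powers *)

Section real_sequences.
Context {R : realType}.
Implicit Types (u : R ^nat) (l s : R).

Lemma cvgn_geometric_increments (K : R) u :
  (forall n, `|u n - u n.+1| <= K * 2^-1 ^+ n) -> cvgn u.
Proof.
move=> uK; have cT : cvgn (series (telescope u)).
  apply: normed_cvg; apply: (@series_le_cvg _ _ (geometric K 2^-1)).
  - by move=> n; rewrite /= normr_ge0.
  - by move=> n; exact: le_trans (normr_ge0 _) (uK n).
  - by move=> n /=; rewrite /telescope/= distrC.
  - by apply: is_cvg_geometric_series; rewrite gtr0_norm; lra.
suff -> : u = (fun n => u 0%N + series (telescope u) n).
  by apply: is_cvgD => //; exact: is_cvg_cst.
by apply/funext => n; exact: eq_sum_telescope.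
Qed.

Lemma cvgn_powR s u l : 0 < l -> u n @[n --> \oo] --> l ->
  u n `^ s @[n --> \oo] --> l `^ s.
Proof.
move=> l0 ul; have : {for l, continuous (@powR R ^~ s)}.
  apply: differentiable_continuous; apply/derivable1_diffP/derivable_powR.
  by rewrite in_itv/= andbT.
move=> cl; exact: (@continuous_cvg nat R R \oo _ u (@powR R ^~ s) l).
Qed.

(** A positive exponent allows the limit 0 as well: there [u n ^ s < e] as soon as
    [u n < e ^ (1 / s)]. *)
Lemma cvgn_powR_ge0 s u l : 0 < s -> (forall n, 0 <= u n) ->
  u n @[n --> \oo] --> l -> u n `^ s @[n --> \oo] --> l `^ s.
Proof.
move=> s0 u0 ul; have l0 : 0 <= l.
  by rewrite -(cvg_lim _ ul)//; apply: limr_ge; [apply/cvg_ex; exists l | exact: nearW].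
move: l0; rewrite le_eqVlt => /predU1P[l0|l0]; last exact: cvgn_powR.
rewrite -l0 powR0 ?gt_eqF//; apply/cvgr0Pnorm_lt => e e0.
rewrite -l0 in ul; move/cvgr0Pnorm_lt : ul => /(_ _ (powR_gt0 s^-1 e0)).
apply: filterS => n; rewrite ger0_norm// => une.
rewrite ger0_norm ?powR_ge0//.
have -> : e = (e `^ s^-1) `^ s by rewrite -powRrM mulVf ?gt_eqF// powRr1// ltW.
by apply: gt0_ltr_powR => //; rewrite nnegrE// powR_ge0.
Qed.

End real_sequences.

(** * Almost everywhere convergence from integral bounds *)

Section ae_convergence.
Local Open Scope ereal_scope.
Context d (T : measurableType d) (R : realType).
Variable mu : {measure set T -> \bar R}.

Lemma ae_fin_num_integral (F : T -> \bar R) : measurable_fun setT F ->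
  (forall w, 0 <= F w) -> \int[mu]_w F w < +oo ->
  {ae mu, forall w, F w \is a fin_num}.
Proof.
move=> mF F0 iF; have : mu.-integrable setT F.
  apply/integrableP; split => //.
  by under eq_integral do rewrite gee0_abs//.
by move=> /(integrable_ae measurableT); apply: filterS => w; apply.
Qed.

(* [\sum_n 4 ^ n * (v n - v n.+1) ^ 2] is integrable, hence finite almost
   everywhere, which dominates the increments by a geometric sequence. *)
Lemma ae_cvgn_sqr_increments (M : R) (v : nat -> T -> R) :
  (forall n, measurable_fun setT (v n)) ->
  (forall n, \int[mu]_w (((v n w - v n.+1 w) ^+ 2)%R%:E)
             <= (M * 8^-1 ^+ n)%R%:E) ->
  {ae mu, forall w, cvgn (v ^~ w)}.
Proof.
move=> mv Mv; pose D n w := ((v n w - v n.+1 w) ^+ 2)%R.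
have D0 n w : (0 <= D n w)%R by exact: sqr_ge0.
have mD n : measurable_fun setT (D n).
  by apply: measurable_funX; exact: measurable_funB.
pose t n w := (4 ^+ n * D n w)%R%:E.
have t0 n w : 0 <= t n w by rewrite lee_fin mulr_ge0// exprn_ge0.
have mt n : measurable_fun setT (t n).
  by apply/measurable_EFinP; exact: measurable_funM.
have M0 : (0 <= M)%R.
  rewrite -lee_fin -[M]mulr1 -(expr0 8^-1); apply: le_trans (Mv 0%N).
  by apply: integral_ge0 => w _; rewrite lee_fin sqr_ge0.
pose F w := \sum_(n <oo) t n w.
have iF : \int[mu]_w F w < +oo.
  rewrite integral_nneseries//.
  (* Here [4 ^ n * M * 8 ^ -n = M * 2 ^ -n], written as [2 M / 2 ^ (n + 1)] to match the known sum
     of the geometric series. *)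
  apply: (@le_lt_trans _ _ (\sum_(n <oo) (2 * M / (2 ^ (n + 1))%:R)%R%:E)).
    apply: lee_nneseries => [n _ _|n _]; first exact: integral_ge0.
    under eq_integral do rewrite /t EFinM.
    rewrite ge0_integralZl_EFin//; last 2 first.
    - by move=> w _; rewrite lee_fin.
    - exact/measurable_EFinP.
    apply: (@le_trans _ _ ((4 ^+ n)%R%:E * (M * 8^-1 ^+ n)%R%:E)).
      by apply: lee_wpmul2l; [rewrite lee_fin exprn_ge0|exact: Mv].
    rewrite -EFinM lee_fin le_eqVlt; apply/orP; left; apply/eqP.
    have -> : (8 : R)%R = (4 * 2)%R by ring.
    rewrite addn1 expnS natrM natrX exprVn exprMn; field.
    by rewrite !expf_neq0.
  have /cvg_lim -> // := @cvg_geometric_eseries_half R (2 * M) 0.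
  by rewrite ltry.
have mF : measurable_fun setT F.
  apply: (emeasurable_fun_cvg (fun n w => \sum_(0 <= k < n) t k w)).
    by move=> n; exact: emeasurable_sum.
  by move=> w _; apply: is_cvg_nneseries => n _ _.
have F0 w : 0 <= F w by exact: nneseries_ge0.
have := ae_fin_num_integral mF F0 iF; apply: filterS => w Fw.
have tF n : t n w <= (fine (F w))%:E.
  rewrite fineK//; apply: le_trans (nneseries_lim_ge n.+1 _) => //.
  by rewrite big_nat_recr//= leeDr// sume_ge0.
(* Each term [4 ^ n * D n w] is at most the sum [F w]; square roots give increments of at most
   [sqrt (F w) * 2 ^ -n]. *)
apply: (@cvgn_geometric_increments _ (Num.sqrt (fine (F w)))) => n.
have := tF n; rewrite lee_fin => {}tF.
have -> : (2^-1 ^+ n = Num.sqrt (4^-1 ^+ n) :> R)%R.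
  have -> : (4^-1 : R)%R = (2^-1 ^+ 2)%R by field.
  by rewrite exprAC sqrtr_sqr ger0_norm// exprn_ge0.
rewrite -sqrtrM ?fine_ge0// -sqrtr_sqr ler_sqrt ?sqr_ge0//.
  by rewrite exprVn ler_pdivlMr ?exprn_gt0// mulrC.
by rewrite mulr_ge0 ?fine_ge0// exprn_ge0.
Qed.

(** The finite part of the upper limit is measurable and nonnegative everywhere, and it is the limit
    wherever the sequence converges. *)
Lemma ae_cvgn_measurable_limit (f : nat -> T -> R) :
  (forall n, measurable_fun setT (f n)) -> (forall n w, (0 <= f n w)%R) ->
  {ae mu, forall w, cvgn (f ^~ w)} ->
  exists g : T -> R, [/\ measurable_fun setT g, forall w, (0 <= g w)%R &
    {ae mu, forall w, f n w @[n --> \oo] --> g w}].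
Proof.
move=> mf f0 cf; exists (fun w => fine (limn_esup (fun n => (f n w)%:E))).
split.
- apply/measurableT_comp => //; apply: measurable_fun_limn_esup => n.
  exact/measurable_EFinP.
- move=> w; apply: fine_ge0; apply: le_trans (limn_einf_sup _).
  rewrite limn_einf_lim; apply: lime_ge; first exact: is_cvg_einfs.
  apply: nearW => n; apply: le_ereal_inf_tmp => _ [m _ <-].
  by rewrite lee_fin.
- apply: filterS cf => w /cvg_ex[l fl].
  have fl' : (f n w)%:E @[n --> \oo] --> l%:E by exact/cvg_EFin/fl/nearW.
  by have [_ ->] := cvg_limn_einf_sup fl'.
Qed.

End ae_convergence.

(** * Measurability of positivity and vanishing sets *)

Section measurable_sets.
Context d (T : measurableType d) (R : realType).
Implicit Types f g : T -> R.

Lemma measurable_gt0 f : measurable_fun setT f -> measurable [set w | 0 < f w].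
Proof.
move=> mf; rewrite -[X in measurable X]setTI.
rewrite -/((fun w => 0 < f w) @^-1` [set true]).
exact: measurable_fun_ltr.
Qed.

Lemma measurable_gt0_eq0 f g : measurable_fun setT f -> measurable_fun setT g ->
  measurable [set w | 0 < f w /\ g w = 0].
Proof.
move=> mf mg; apply: measurableI; first exact: measurable_gt0.
have -> : (fun w => g w = 0) = (fun w => g w == 0) @^-1` [set true].
  by apply/seteqP; split => w /= /eqP.
by rewrite -[X in measurable X]setTI; exact: measurable_fun_eqr.
Qed.

End measurable_sets.

(** * Fatou's lemma for almost everywhere limits *)

Section fatou_limit.
Local Open Scope ereal_scope.
Context d (T : measurableType d) (R : realType).
Variable mu : {measure set T -> \bar R}.

(** [G] agrees almost everywhere with the lower limit of [F n], and the lower limit of the integrals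
    is at most that of the bounds [s n]. The values of [G] are extended reals, so that pointwise
    divergence to [+oo] is covered. *)
Lemma fatou_cvg (D : set T) (F : nat -> T -> \bar R) (G : T -> \bar R)
    (s : nat -> R) (l : R) :
  measurable D -> (forall n, measurable_fun D (F n)) ->
  (forall n w, D w -> 0 <= F n w) -> measurable_fun D G ->
  (forall w, D w -> 0 <= G w) ->
  {ae mu, forall w, D w -> F n w @[n --> \oo] --> G w} ->
  (forall n, \int[mu]_(w in D) F n w <= (s n)%:E) ->
  s n @[n --> \oo] --> l ->
  \int[mu]_(w in D) G w <= l%:E.
Proof.
move=> mD mF F0 mG G0 FG Fs sl.
have -> : \int[mu]_(w in D) G w = \int[mu]_(w in D) limn_einf (F ^~ w).
  apply: ge0_ae_eq_integral => //.
  (* Measurability of the lower limit is taken from that of the upper limit of [- F n]. *)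
  - have -> : (fun w => limn_einf (F ^~ w)) =
        (fun w => - limn_esup (fun n => - F n w)).
      by apply/funext => w; rewrite -limn_einfN; congr limn_einf;
        apply/funext => n /=; rewrite oppeK.
    apply: measurableT_comp => //; apply: measurable_fun_limn_esup => n.
    exact: measurableT_comp.
  - move=> w Dw; rewrite limn_einf_lim; apply: lime_ge; first exact: is_cvg_einfs.
    by apply: nearW => n; apply: le_ereal_inf_tmp => _ [m _ <-]; exact: F0.
  - apply: filterS FG => w FG Dw.
    by have [-> _] := cvg_limn_einf_sup (FG Dw).
apply: le_trans (fatou mu mD mF F0) _.
rewrite limn_einf_lim -(cvg_lim _ sl)// -EFin_lim; last by apply/cvg_ex; exists l.
apply: lee_lim; first exact: is_cvg_einfs.
  by apply/cvg_ex; exists l%:E; apply/cvg_EFin/sl/nearW.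
apply: nearW => n; apply: le_trans (Fs n).
by apply: ereal_inf_lbound; exists n => /=.
Qed.

End fatou_limit.

(** Sigma-finiteness yields a set of finite positive measure, and its normalized indicator is a
    density. This serves the degenerate case where the maximizing limit vanishes almost
    everywhere. *)
Lemma exists_density d (T : measurableType d) (R : realType)
    (mu : {sigma_finite_measure set T -> \bar R}) :
  mu [set: T] != 0%E -> exists h, density_function mu h.
Proof.
move=> mu0; have [F TF mF] := sigma_finiteT mu.
have [n muFn] : exists n, mu (F n) != 0%E.
  apply/not_existsP => F0; move/eqP : mu0; apply; rewrite TF.
  apply/eqP; rewrite eq_le measure_ge0 andbT.
  apply: (@le_trans _ _ (\sum_(i <oo) mu (F i))%E).
    apply: measure_sigma_subadditive => //.
      by move=> i; exact: (mF i).1.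
    by apply: bigcup_measurable => i _; exact: (mF i).1.
  by rewrite eseries0// => i _ _; apply/eqP/negbNE/negP; exact: F0.
have [mFn muFoo] := mF n.
have muFfin : mu (F n) \is a fin_num by rewrite ge0_fin_numE.
have muF0 : 0 < fine (mu (F n)).
  by rewrite fine_gt0// muFoo andbT lt0e muFn measure_ge0.
exists (fun w => (fine (mu (F n)))^-1 * \1_(F n) w); split.
- by apply: measurable_funM => //; exact: measurable_indic.
- by move=> w; rewrite mulr_ge0// invr_ge0 ltW.
- under eq_integral do rewrite EFinM.
  rewrite ge0_integralZl_EFin//; last 2 first.
  + by apply/measurable_EFinP; exact: measurable_indic.
  + by rewrite invr_ge0 ltW.
  by rewrite integral_indic// setIT -[X in (_ * X)%E]fineK// -EFinM mulVf// gt_eqF.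
Qed.

(** * Near-maximizers of the integral of [f ^ r] over a convex set *)

Section convex_maximization.
Local Open Scope ereal_scope.
Context d (T : measurableType d) (R : realType).
Variable mu : {measure set T -> \bar R}.
Variables (r : R) (K : set (T -> R)).
Hypothesis r01 : (0 < r < 1)%R.
Hypothesis mK : forall f, K f -> measurable_fun setT f.
Hypothesis K_ge0 : forall f, K f -> forall w, (0 <= f w)%R.
Hypothesis K_convex : forall f g (t : R), K f -> K g -> (0 <= t <= 1)%R ->
  K (fun w => t * f w + (1 - t) * g w)%R.
Hypothesis K_nonempty : K !=set0.
Hypothesis K_le1 : forall f, K f -> \int[mu]_w (f w `^ r)%:E <= 1.

Local Notation Phi f := (\int[mu]_w (f w `^ r)%:E).

Let r_gt0 : (0 < r)%R. Proof. by case/andP: r01. Qed.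

Let r_lt1 : (r < 1)%R. Proof. by case/andP: r01. Qed.

Let measurable_powR_fun (f : T -> R) s : measurable_fun setT f ->
  measurable_fun setT (fun w => (f w `^ s)%:E).
Proof.
move=> mf; apply/measurable_EFinP.
exact: (@measurableT_comp _ _ _ _ _ _ (@powR R ^~ s)).
Qed.

Let Phi_ge0 f : 0 <= Phi f.
Proof. by apply: integral_ge0 => w _; rewrite lee_fin powR_ge0. Qed.

Lemma exists_supremum : exists S : R, [/\ (S <= 1)%R,
  forall f, K f -> Phi f <= S%:E &
  forall e, (0 < e)%R -> exists2 f, K f & (S - e)%:E <= Phi f].
Proof.
pose A := [set fine (Phi f) | f in K].
have PhiE f : K f -> Phi f = (fine (Phi f))%:E.
  move=> Kf; rewrite fineK// ge0_fin_numE//.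
  by rewrite (le_lt_trans (K_le1 Kf))// ltry.
have A1 : ubound A 1%R.
  by move=> _ [f Kf <-]; rewrite -lee_fin -PhiE//; exact: K_le1.
have supA : has_sup A.
  split; last by exists 1%R.
  by case: K_nonempty => f Kf; exists (fine (Phi f)); exists f.
exists (sup A); split.
- by apply: ge_sup => //; case: supA.
- move=> f Kf; rewrite PhiE// lee_fin.
  by apply: ub_le_sup; [case: supA|exists f].
- move=> e e0; have [_ [f Kf <-] /ltW Sf] := sup_adherent e0 supA.
  by exists f => //; rewrite PhiE// lee_fin.
Qed.

Variable S : R.
Hypothesis K_leS : forall f, K f -> Phi f <= S%:E.

(* Strict concavity of [t ^ r]: two near-maximizers are close to each other,
   otherwise their midpoint would do better than the supremum. *)
Lemma near_maximizers_dist (f g : T -> R) (e : R) : K f -> K g ->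
  (S - e)%:E <= Phi f -> (S - e)%:E <= Phi g ->
  \int[mu]_w ((f w `^ (r / 2) - g w `^ (r / 2)) ^+ 2)%:E
    <= ((r * (1 - r) / 32)^-1 * e)%:E.
Proof.
move=> Kf Kg Sf Sg; set c := (r * (1 - r) / 32)%R.
have c0 : (0 < c)%R by rewrite divr_gt0// mulr_gt0// subr_gt0.
pose h w := (2^-1 * f w + (1 - 2^-1) * g w)%R.
have Kh : K h by apply: K_convex => //; lra.
set D := \int[mu]_w _.
have mf := mK Kf; have mg := mK Kg.
have mD : measurable_fun setT (fun w => ((f w `^ (r / 2) - g w `^ (r / 2)) ^+ 2)%R%:E).
  apply/measurable_EFinP; apply: measurable_funX; apply: measurable_funB.
    exact/measurable_EFinP/measurable_powR_fun.
  exact/measurable_EFinP/measurable_powR_fun.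
have D0 w : [set: T] w -> 0 <= ((f w `^ (r / 2) - g w `^ (r / 2)) ^+ 2)%R%:E.
  by rewrite lee_fin sqr_ge0.
(* [powR_midpoint_gap] is integrated; the midpoint [h] is in [K], so its integral is at most [S]. *)
have : (2^-1)%:E * Phi f + (2^-1)%:E * Phi g + c%:E * D <= S%:E.
  apply: le_trans (K_leS Kh).
  rewrite -!ge0_integralZl_EFin ?(ltW c0)//; try (by move=> w _; rewrite lee_fin powR_ge0);
    try exact: measurable_powR_fun.
  rewrite -!ge0_integralD//.
  - apply: ge0_le_integral => //.
    + by move=> w _; rewrite -!EFinM -!EFinD lee_fin !addr_ge0// mulr_ge0 ?powR_ge0 ?sqr_ge0 ?ltW.
    + apply: emeasurable_funD; [apply: emeasurable_funD|];
        apply: measurable_funeM => //; exact: measurable_powR_fun.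
    + exact/measurable_powR_fun/mK.
    + move=> w _; rewrite -!EFinM -!EFinD lee_fin.
      have := powR_midpoint_gap r01 (K_ge0 Kf w) (K_ge0 Kg w).
      have -> : ((f w + g w) / 2 = h w)%R by rewrite /h; field.
      by apply: le_trans; rewrite /c; lra.
  - by move=> w _; rewrite -!EFinM -!EFinD lee_fin !addr_ge0// mulr_ge0 ?powR_ge0 ?sqr_ge0 ?ltW.
  - apply: emeasurable_funD; apply: measurable_funeM => //; exact: measurable_powR_fun.
  - by move=> w _; rewrite -!EFinM lee_fin mulr_ge0 ?sqr_ge0 ?ltW.
  - exact: measurable_funeM.
  - by move=> w _; rewrite -!EFinM lee_fin mulr_ge0 ?powR_ge0 ?ltW.
  - by apply: measurable_funeM => //; exact: measurable_powR_fun.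
  - by move=> w _; rewrite -!EFinM lee_fin mulr_ge0 ?powR_ge0 ?ltW.
  - by apply: measurable_funeM => //; exact: measurable_powR_fun.
move=> SD; have {}SD : (S - e)%:E + c%:E * D <= S%:E.
  apply: le_trans SD; rewrite leeD2r//.
  have -> : (S - e)%:E = (2^-1)%:E * (S - e)%:E + (2^-1)%:E * (S - e)%:E.
    by rewrite -!EFinM -EFinD; congr EFin; field.
  by apply: leeD; apply: lee_wpmul2l => //; rewrite lee_fin.
have {}SD : c%:E * D <= e%:E.
  have -> : e%:E = S%:E - (S - e)%:E by rewrite -EFinB; congr EFin; ring.
  by rewrite leeBrDl.
rewrite EFinM; apply: (@le_trans _ _ ((c^-1)%:E * (c%:E * D))).
  by rewrite muleA -EFinM mulVf ?gt_eqF// mul1e.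
by apply: lee_wpmul2l => //; rewrite lee_fin invr_ge0 ltW.
Qed.

(* First-order optimality, from [Phi (f + t g) <= (1 + t) ^ r S] and concavity. *)
Lemma near_maximizer_variation (f g : T -> R) (e t : R) : K f -> K g ->
  (S - e)%:E <= Phi f -> (0 < t)%R ->
  \int[mu]_w (g w * (f w + t * g w) `^ (r - 1))%:E <= (S + e / (r * t))%:E.
Proof.
move=> Kf Kg Sf t0; have mf := mK Kf; have mg := mK Kg.
have rt0 : (0 < r * t)%R by exact: mulr_gt0.
have f0 := K_ge0 Kf; have g0 := K_ge0 Kg; have t_ge0 := ltW t0; have rt_ge0 := ltW rt0.
have t1 : (0 < 1 + t)%R by rewrite addr_gt0.
have u0 w : (0 <= f w + t * g w)%R by rewrite addr_ge0// mulr_ge0.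
have mu_ : measurable_fun setT (fun w => f w + t * g w)%R.
  by apply: measurable_funD => //; exact: measurable_funM.
have S0 : (0 <= S)%R by rewrite -lee_fin; exact: le_trans (K_leS Kf).
(* [f + t g] is [1 + t] times a convex combination of [f] and [g], and [(1 + t) ^ r <= 1 + r t]. *)
have leS : Phi (fun w => f w + t * g w)%R <= ((1 + r * t) * S)%:E.
  pose s := (1 + t)^-1%R.
  have Kh : K (fun w => s * f w + (1 - s) * g w)%R.
    apply: K_convex => //; rewrite invr_ge0 ltW//= invf_le1//.
    by rewrite lerDl ltW.
  have sE : (1 - s = s * t)%R by rewrite /s; field; rewrite gt_eqF.
  apply: (@le_trans _ _ (((1 + t) `^ r)%:E * Phi (fun w => s * f w + (1 - s) * g w)%R)).
    rewrite -ge0_integralZl_EFin ?powR_ge0//; last 2 first.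
    - by move=> w _; rewrite lee_fin powR_ge0.
    - exact/measurable_powR_fun/mK.
    apply: ge0_le_integral => //.
    - by move=> w _; rewrite lee_fin powR_ge0.
    - exact: measurable_powR_fun.
    - by apply: measurable_funeM => //; exact/measurable_powR_fun/mK.
    - move=> w _; rewrite -EFinM lee_fin -powRM ?(ltW t1)//; last exact: (K_ge0 Kh).
      rewrite le_eqVlt; apply/orP; left; apply/eqP; congr (_ `^ _)%R.
      by rewrite sE /s; field; rewrite gt_eqF.
  apply: (@le_trans _ _ (((1 + t) `^ r)%:E * S%:E)).
    by apply: lee_wpmul2l; [rewrite lee_fin powR_ge0|exact: K_leS].
  rewrite -EFinM lee_fin; apply: ler_wpM2r => //.
  have := powR_le_affine (ltW t1) r_gt0 (ltW r_lt1).
  by move=> /le_trans; apply; rewrite le_eqVlt; apply/orP; left; apply/eqP; ring.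
set I := \int[mu]_w _.
have mI : measurable_fun setT (fun w => (g w * (f w + t * g w) `^ (r - 1))%:E).
  apply/measurable_EFinP; apply: measurable_funM => //.
  exact/measurable_EFinP/measurable_powR_fun.
have I0 w : [set: T] w -> 0 <= (g w * (f w + t * g w) `^ (r - 1))%:E.
  by rewrite lee_fin mulr_ge0// powR_ge0.
(* The tangent is taken at [f + t g] rather than at [f]: this point is positive wherever [g] is, so
   the negative power [r - 1] keeps its usual meaning there. *)
have : Phi f + (r * t)%:E * I <= ((1 + r * t) * S)%:E.
  apply: le_trans leS.
  rewrite -ge0_integralZl_EFin ?(ltW rt0)//.
  rewrite -ge0_integralD//.
  - apply: ge0_le_integral => //.
    + by move=> w _; rewrite -EFinM -EFinD lee_fin;
        exact: addr_ge0 (powR_ge0 _ _) (mulr_ge0 rt_ge0 (mulr_ge0 (g0 w) (powR_ge0 _ _))).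
    + by apply: emeasurable_funD; [exact: measurable_powR_fun|exact: measurable_funeM].
    + exact: measurable_powR_fun.
    + move=> w _; rewrite -EFinM -EFinD lee_fin.
      have fu : (f w <= f w + t * g w)%R by rewrite lerDl mulr_ge0.
      have := powR_tangent r01 (f0 w) fu; apply: le_trans.
      by rewrite le_eqVlt; apply/orP; left; apply/eqP; ring.
  - by move=> w _; rewrite lee_fin powR_ge0.
  - exact: measurable_powR_fun.
  - by move=> w _; rewrite -EFinM lee_fin;
        exact: mulr_ge0 rt_ge0 (mulr_ge0 (g0 w) (powR_ge0 _ _)).
  - exact: measurable_funeM.
move=> le1; have {}le1 : (S - e)%:E + (r * t)%:E * I <= ((1 + r * t) * S)%:E.
  by apply: le_trans le1; rewrite leeD2r.
have {}le1 : (r * t)%:E * I <= (r * t * S + e)%:E.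
  have -> : (r * t * S + e = (1 + r * t) * S - (S - e))%R by ring.
  by rewrite EFinB leeBrDl.
apply: (@le_trans _ _ (((r * t)^-1)%:E * ((r * t)%:E * I))).
  by rewrite muleA -EFinM mulVf ?gt_eqF// mul1e.
apply: (@le_trans _ _ (((r * t)^-1)%:E * (r * t * S + e)%:E)).
  by apply: lee_wpmul2l => //; rewrite lee_fin invr_ge0 ltW.
rewrite -EFinM lee_fin le_eqVlt; apply/orP; left; apply/eqP.
by field; rewrite !gt_eqF.
Qed.

End convex_maximization.

(** * The limit of a fast maximizing sequence and its optimality *)

Section maximizing_limit.
Local Open Scope ereal_scope.
Context d (T : measurableType d) (R : realType).
Variable mu : {measure set T -> \bar R}.
Variables (r : R) (K : set (T -> R)) (S : R).
Hypothesis r01 : (0 < r < 1)%R.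
Hypothesis mK : forall f, K f -> measurable_fun setT f.
Hypothesis K_ge0 : forall f, K f -> forall w, (0 <= f w)%R.
Hypothesis K_convex : forall f g (t : R), K f -> K g -> (0 <= t <= 1)%R ->
  K (fun w => t * f w + (1 - t) * g w)%R.
Hypothesis K_leS : forall f, K f -> \int[mu]_w (f w `^ r)%:E <= S%:E.

(** Choosing [f_ n] within [8 ^ -n] of the supremum gives, by [near_maximizers_dist], square
    increments of [f_ n ^ (r / 2)] with integrals of order [8 ^ -n]. These powers converge almost
    everywhere, and the exponent [2 / r] carries the convergence back to [f_ n]. *)
Lemma exists_maximizing_limit :
  (forall e, (0 < e)%R ->
    exists2 f, K f & (S - e)%:E <= \int[mu]_w (f w `^ r)%:E) ->
  exists (f_ : nat -> T -> R) (f : T -> R),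
    [/\ forall n, K (f_ n),
      forall n, (S - 8^-1 ^+ n)%:E <= \int[mu]_w (f_ n w `^ r)%:E,
      measurable_fun setT f, forall w, (0 <= f w)%R &
      {ae mu, forall w, f_ n w @[n --> \oo] --> f w}].
Proof.
have /andP[r0 r1] := r01; move=> Ssup.
have /choice[f_ Kf_] : forall n, exists f, K f /\
    (S - 8^-1 ^+ n)%:E <= \int[mu]_w (f w `^ r)%:E.
  move=> n; have e0 : (0 < 8^-1 ^+ n :> R)%R by rewrite exprn_gt0.
  by have [f Kf Sf] := Ssup _ e0; exists f.
have Kf n : K (f_ n) by have [] := Kf_ n.
have Sf n : (S - 8^-1 ^+ n)%:E <= \int[mu]_w (f_ n w `^ r)%:E by have [] := Kf_ n.
have r20 : (0 < r / 2)%R by rewrite divr_gt0.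
have cv : {ae mu, forall w, cvgn (fun n => f_ n w `^ (r / 2))}%R.
  apply: (@ae_cvgn_sqr_increments _ _ _ mu (r * (1 - r) / 32)^-1
    (fun n w => f_ n w `^ (r / 2))%R).
    move=> n; apply: (@measurableT_comp _ _ _ _ _ _ (@powR R ^~ (r / 2)%R)) => //.
    exact: mK.
  move=> n; apply: (near_maximizers_dist r01 mK K_ge0 K_convex K_leS) => //.
  apply: le_trans (Sf n.+1); rewrite lee_fin lerB// exprS.
  by rewrite ler_piMl// ?exprn_ge0//; lra.
have cf : {ae mu, forall w, cvgn (f_ ^~ w)}.
  apply: filterS cv => w /cvg_ex[l vl]; apply/cvg_ex; exists (l `^ (r / 2)^-1)%R.
  have := cvgn_powR_ge0 (s := (r / 2)^-1) _ _ vl.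
  rewrite invr_gt0 => /(_ r20 (fun=> powR_ge0 _ _)).
  have -> : (fun n => ((f_ n w `^ (r / 2)) `^ (r / 2)^-1)%R) = f_ ^~ w; last by [].
  apply/funext => n; rewrite -powRrM mulfV ?gt_eqF// powRr1//.
  exact: K_ge0.
have mf_ n : measurable_fun setT (f_ n) by exact: mK.
have f_0 n w : (0 <= f_ n w)%R by exact: K_ge0.
have [f [mf f0 ff]] := ae_cvgn_measurable_limit mf_ f_0 cf.
by exists f_, f; split.
Qed.

Variables (f_ : nat -> T -> R) (f : T -> R).
Hypothesis Kf_ : forall n, K (f_ n).
Hypothesis Sf_ : forall n,
  (S - 8^-1 ^+ n)%:E <= \int[mu]_w (f_ n w `^ r)%:E.
Hypothesis mf : measurable_fun setT f.
Hypothesis f_f : {ae mu, forall w, f_ n w @[n --> \oo] --> f w}.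

Lemma maximizing_limit_le : \int[mu]_w (f w `^ r)%:E <= S%:E.
Proof.
have /andP[r0 _] := r01.
have mpow (g : T -> R) : measurable_fun setT g ->
    measurable_fun setT (fun w => (g w `^ r)%:E).
  move=> mg; apply/measurable_EFinP.
  exact: (@measurableT_comp _ _ _ _ _ _ (@powR R ^~ r)).
apply: (@fatou_cvg _ _ _ mu setT (fun n w => (f_ n w `^ r)%:E) _ (fun=> S)) => //.
- by move=> n; exact/mpow/mK.
- by move=> n w _; rewrite lee_fin powR_ge0.
- exact: mpow.
- by move=> w _; rewrite lee_fin powR_ge0.
- apply: filterS f_f => w fw _; apply: cvg_EFin; first exact: nearW.
  by apply: cvgn_powR_ge0 => // n; exact: K_ge0.
- by move=> n; exact: K_leS.
- exact: cvg_cst.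
Qed.

(** The integrand of [near_maximizer_variation] at [f_ n] with step [t = 2 ^ -n]. The step tends to
    0, and so does the error [8 ^ -n / (r t) = r^-1 * 4 ^ -n]. *)
Let J g n w := (g w * (f_ n w + 2^-1 ^+ n * g w) `^ (r - 1))%R.

Let mJ g n : K g -> measurable_fun setT (fun w => (J g n w)%:E).
Proof.
move=> Kg; apply/measurable_EFinP; apply: measurable_funM; first exact: mK.
apply: (@measurableT_comp _ _ _ _ _ _ (@powR R ^~ (r - 1)%R)) => //.
by apply: measurable_funD; [exact: mK|apply: measurable_funM => //; exact: mK].
Qed.

Let J_ge0 g n w : K g -> 0 <= (J g n w)%:E.
Proof. by move=> Kg; rewrite lee_fin mulr_ge0 ?powR_ge0// K_ge0. Qed.

Let int_J_le g n D : K g -> measurable D ->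
  \int[mu]_(w in D) (J g n w)%:E <= (S + r^-1 * 4^-1 ^+ n)%:E.
Proof.
have /andP[r0 _] := r01; move=> Kg mD.
apply: (@le_trans _ _ (\int[mu]_w (J g n w)%:E)).
  by apply: ge0_subset_integral => //; [exact: mJ|move=> w _; exact: J_ge0].
have e0 : (0 < 2^-1 ^+ n :> R)%R by rewrite exprn_gt0.
have := near_maximizer_variation r01 mK K_ge0 K_convex K_leS (Kf_ n) Kg (Sf_ n) e0.
move=> /le_trans; apply; rewrite lee_fin lerD2l le_eqVlt; apply/orP; left; apply/eqP.
have -> : (8 : R)%R = (4 * 2)%R by ring.
rewrite !exprVn exprMn; field.
by rewrite !expf_neq0// gt_eqF.
Qed.

Let cvg_bound : (S + r^-1 * 4^-1 ^+ n)%R @[n --> \oo] --> S.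
Proof.
rewrite -[X in _ --> X]addr0; apply: cvgD; first exact: cvg_cst.
by apply: cvg_geometric; rewrite gtr0_norm; lra.
Qed.

Let cvg_perturbed (g : T -> R) w (l : R) : f_ n w @[n --> \oo] --> l ->
  (f_ n w + 2^-1 ^+ n * g w)%R @[n --> \oo] --> l.
Proof.
move=> fl; rewrite -[X in _ --> X]addr0; apply: cvgD => //.
under eq_fun do rewrite mulrC.
by apply: (@cvg_geometric _ (g w)); rewrite gtr0_norm; lra.
Qed.

(** Where [f > 0] the power [r - 1] is continuous at the limit, so [J g n] converges to
    [g f ^ (r - 1)] and Fatou's lemma applies. *)
Lemma maximizing_limit_optimal g : K g ->
  \int[mu]_(w in [set w | (0 < f w)%R]) (g w * f w `^ (r - 1))%:E <= S%:E.
Proof.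
move=> Kg; have mD := measurable_gt0 mf.
apply: (@fatou_cvg _ _ _ mu _ (fun n w => (J g n w)%:E) _ _ S mD _ _ _ _ _ _ cvg_bound).
- by move=> n; apply: measurable_funTS; exact: mJ.
- by move=> n w _; exact: J_ge0.
- apply: measurable_funTS; apply/measurable_EFinP.
  apply: measurable_funM; first exact: mK.
  exact: (@measurableT_comp _ _ _ _ _ _ (@powR R ^~ (r - 1)%R)).
- by move=> w _; rewrite lee_fin mulr_ge0 ?powR_ge0// K_ge0.
- apply: filterS f_f => w fw /= fw0; apply: cvg_EFin; first exact: nearW.
  apply: cvgM; first exact: cvg_cst.
  apply: cvgn_powR => //; exact: cvg_perturbed.
- by move=> n; exact: int_J_le.
Qed.

(** On this set [J g n] tends to [+oo], because [r - 1 < 0]. If the set had positive measure,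
    Fatou's lemma would bound an infinite integral by [S]. *)
Lemma maximizing_limit_support g : K g ->
  mu [set w | (0 < g w)%R /\ f w = 0%R] = 0.
Proof.
have /andP[r0 r1] := r01.
move=> Kg; set N := [set w | _].
have mN : measurable N by apply: measurable_gt0_eq0 => //; exact: mK.
apply/eqP/negPn/negP => N0.
suff : \int[mu]_(w in N) (cst +oo) w <= S%:E.
  by rewrite integral_cst// gt0_mulye ?lt0e ?N0 ?measure_ge0// leye_eq.
apply: (@fatou_cvg _ _ _ mu _ (fun n w => (J g n w)%:E) _ _ S mN _ _ _ _ _ _ cvg_bound) => //.
- by move=> n; apply: measurable_funTS; exact: mJ.
- by move=> n w _; exact: J_ge0.
- by move=> w _; exact: leey.
- apply: filterS f_f => w fw /= [gw0 fw0].
  have u0 n : (0 < f_ n w + 2^-1 ^+ n * g w)%R.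
    by rewrite ltr_wpDl ?K_ge0// mulr_gt0// exprn_gt0.
  rewrite fw0 in fw; have := @cvg_perturbed g _ _ fw.
  move=> /(@cvgn_powR_ge0 _ (1 - r)); rewrite subr_gt0 powR0; last by lra.
  move=> /(_ r1 (fun n => ltW (u0 n))) u1.
  apply/cvgeryP.
  (* The reciprocal of [J g n w] is positive and tends to 0, its power having the positive exponent
     [1 - r]. *)
  have -> : (fun n => J g n w) = 
    unstable.inv_fun (fun n => (g w)^-1 * (f_ n w + 2^-1 ^+ n * g w) `^ (1 - r))%R.
    apply/funext => n /=; rewrite /J -opprB powRN.
    by rewrite invfM invrK.
  apply/cvgrVy.
    by apply: nearW => n; rewrite mulr_gt0 ?invr_gt0 ?powR_gt0.
  by rewrite -[X in _ --> X](mulr0 ((g w)^-1)%R); apply: cvgM => //; exact: cvg_cst.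
- by move=> n; exact: int_J_le.
Qed.

End maximizing_limit.

(** * Densities and integrals of [f ^ r], in both directions *)

Section density_change.
Local Open Scope ereal_scope.
Context d (T : measurableType d) (R : realType).

(* Since [0 `^ s = 0] for [s != 0], the integrand already vanishes off [h > 0]. *)
Lemma integral_powR_support (mu : {measure set T -> \bar R}) (h g : T -> R)
    (s : R) : s != 0%R -> (forall w, 0 <= h w)%R ->
  \int[mu]_(w in [set w | (0 < h w)%R]) (g w * h w `^ s)%:E =
  \int[mu]_w (g w * h w `^ s)%:E.
Proof.
move=> s0 h0; rewrite integral_mkcond; apply: eq_integral => w _.
rewrite patchE; case: ifPn => //; rewrite notin_setE/= => /negP.
rewrite -leNgt => hw; have -> : h w = 0%R by apply/eqP; rewrite eq_le hw h0.
by rewrite powR0// mulr0.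
Qed.

(** This is [powR_le_affine] at [x / (k z)] with [z = y ^ (1 / r)], multiplied by
    [(k z) ^ r = k ^ r y]. The scale [k] is left free for later optimization. *)
Lemma powR_density_young (r k x y : R) : (0 < r < 1)%R -> (0 < k)%R ->
  (0 <= x)%R -> (0 < y)%R ->
  (x `^ r <= r * k `^ (r - 1) * (x * y `^ (1 - r^-1)) + (1 - r) * k `^ r * y)%R.
Proof.
move=> /andP[r0 r1] k0 x0 y0.
have kN0 : k != 0%R by rewrite gt_eqF.
have yN0 : y != 0%R by rewrite gt_eqF.
have -> : (k `^ (r - 1) = k `^ r / k)%R.
  by rewrite powRB ?kN0 ?implybT// powRr1// ltW.
have -> : (y `^ (1 - r^-1) = y / y `^ r^-1)%R.
  by rewrite powRB ?yN0 ?implybT// powRr1// ltW.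
set z := (y `^ r^-1)%R; have z0 : (0 < z)%R by exact: powR_gt0.
have zr : (z `^ r = y)%R by rewrite -powRrM mulVf ?gt_eqF// powRr1// ltW.
have u0 : (0 <= x / (z * k))%R by rewrite divr_ge0// ltW// mulr_gt0.
have kr0 : (0 < k `^ r)%R by exact: powR_gt0.
have := ler_wpM2r (ltW (mulr_gt0 kr0 y0)) (powR_le_affine u0 r0 (ltW r1)).
have -> : ((x / (z * k)) `^ r * (k `^ r * y) = x `^ r)%R.
  rewrite -zr [X in (_ * X)%R]mulrC -powRM ?(ltW z0) ?(ltW k0)//.
  rewrite -powRM ?u0 ?(ltW (mulr_gt0 z0 k0))//.
  by rewrite divfK// mulf_neq0// gt_eqF.
move=> /le_trans; apply; rewrite le_eqVlt; apply/orP; left; apply/eqP.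
by field; rewrite kN0 gt_eqF.
Qed.

(** Hölder's inequality for [f ^ r = (f h ^ (1 - 1 / r)) ^ r * h ^ (1 - r)] with exponents [1 / r]
    and [1 / (1 - r)], where [h] has integral 1. *)
Lemma integral_powR_le_density (mu : {measure set T -> \bar R}) (r c : R)
    (h f : T -> R) : (0 < r < 1)%R -> (0 <= c)%R ->
  density_function mu h -> measurable_fun setT f -> (forall w, 0 <= f w)%R ->
  {ae mu, forall w, h w = 0%R -> f w = 0%R} ->
  \int[mu]_(w in [set w | (0 < h w)%R]) (f w * h w `^ (1 - r^-1))%:E <= c%:E ->
  \int[mu]_w (f w `^ r)%:E <= (c `^ r)%:E.
Proof.
move=> r01 c0 [mh h0 ih] mf f0 fh.
have /andP[r0 r1] := r01.
have rV : (1 - r^-1 != 0)%R by rewrite lt_eqF// subr_lt0 invf_gt1.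
rewrite integral_powR_support// => ifh.
have mfr : measurable_fun setT (fun w => (f w `^ r)%:E).
  apply/measurable_EFinP.
  exact: (@measurableT_comp _ _ _ _ _ _ (@powR R ^~ r)).
have mfh : measurable_fun setT (fun w => (f w * h w `^ (1 - r^-1))%:E).
  apply/measurable_EFinP; apply: measurable_funM => //.
  exact: (@measurableT_comp _ _ _ _ _ _ (@powR R ^~ (1 - r^-1)%R)).
have fh0 w : [set: T] w -> 0 <= (f w * h w `^ (1 - r^-1))%:E.
  by rewrite lee_fin mulr_ge0 ?powR_ge0.
have mEh : measurable_fun setT (fun w => (h w)%:E) by exact/measurable_EFinP.
have h0' w : [set: T] w -> 0 <= (h w)%:E by rewrite lee_fin.
(* The choice [k = c] is optimal but must be positive; for [c = 0] the scale [k = e ^ (1 / r)] is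
   used below, with [e] arbitrarily small. *)
have key k : (0 < k)%R -> (c <= k)%R -> \int[mu]_w (f w `^ r)%:E <= (k `^ r)%:E.
  move=> k0 ck; set a := (r * k `^ (r - 1))%R; set b := ((1 - r) * k `^ r)%R.
  have a0 : (0 <= a)%R by rewrite mulr_ge0 ?powR_ge0// ltW.
  have b0 : (0 <= b)%R by rewrite mulr_ge0 ?powR_ge0// subr_ge0 ltW.
  apply: (@le_trans _ _ (\int[mu]_w (a%:E * (f w * h w `^ (1 - r^-1))%:E + b%:E * (h w)%:E))).
    apply: ae_ge0_le_integral => //.
    - by move=> w _; rewrite lee_fin powR_ge0.
    - move=> w wT; apply: adde_ge0; apply: mule_ge0; rewrite ?lee_fin//.
      by rewrite -lee_fin fh0.
    - by apply: emeasurable_funD; exact: measurable_funeM.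
    - apply: filterS fh => w fw _; rewrite -!EFinM -EFinD lee_fin.
      have := h0 w; rewrite le_eqVlt => /predU1P[/esym hw|hw].
        by rewrite fw// powR0 ?gt_eqF// mul0r hw !mulr0 addr0.
      exact: powR_density_young.
  rewrite ge0_integralD//; last 4 first.
  - by move=> w wT; apply: mule_ge0; [rewrite lee_fin|exact: fh0].
  - exact: measurable_funeM.
  - by move=> w wT; apply: mule_ge0; [rewrite lee_fin|exact: h0'].
  - exact: measurable_funeM.
  rewrite !ge0_integralZl_EFin// ih mule1.
  apply: (@le_trans _ _ (a%:E * k%:E + b%:E)).
    rewrite leeD2r//; apply: lee_wpmul2l; first by rewrite lee_fin.
    by apply: le_trans ifh _; rewrite lee_fin.
  rewrite -EFinM -EFinD lee_fin /a /b powRB ?(gt_eqF k0) ?implybT// powRr1 ?(ltW k0)//.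
  by rewrite le_eqVlt; apply/orP; left; apply/eqP; field; rewrite gt_eqF.
move: c0; rewrite le_eqVlt => /predU1P[c0|c0]; last exact: key.
apply/lee_addgt0Pr => e e0; rewrite -c0 powR0 ?gt_eqF// add0e.
have -> : e = ((e `^ r^-1) `^ r)%R by rewrite -powRrM mulVf ?gt_eqF// powRr1// ltW.
by apply: key; rewrite -?c0 ?powR_gt0// powR_ge0.
Qed.

(** With [s] the integral of [f ^ r] and [h = f ^ r / s], one has [h ^ (1 - 1 / r) = s ^ (1 / r - 1)
    f ^ (r - 1)]. The optimality of [f] then bounds the integral by [s ^ (1 / r - 1) S], at most 1
    since [s <= S <= 1]. *)
Lemma maurey_density (mu : {sigma_finite_measure set T -> \bar R}) (r : R)
    (K : set (T -> R)) : mu [set: T] != 0 -> (0 < r < 1)%R ->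
  (forall f, K f -> measurable_fun setT f) ->
  (forall f, K f -> forall w, (0 <= f w)%R) ->
  (forall f g (t : R), K f -> K g -> (0 <= t <= 1)%R ->
    K (fun w => t * f w + (1 - t) * g w)%R) ->
  K !=set0 ->
  (forall f, K f -> \int[mu]_w (f w `^ r)%:E <= 1) ->
  exists h, density_function mu h /\ forall g, K g ->
    \int[mu]_(w in [set w | (0 < h w)%R]) (g w * h w `^ (1 - r^-1))%:E <= 1 /\
    mu [set w | (0 < g w)%R /\ h w = 0%R] = 0.
Proof.
move=> mu0 r01 mK K0 Kcvx Kne K1; have /andP[r0 r1] := r01.
have rV : (1 - r^-1 < 0)%R by rewrite subr_lt0 invf_gt1.
have [S [S1 KS Ssup]] := exists_supremum Kne K1.
have [f_ [f [Kf_ Sf_ mf f0 f_f]]] := exists_maximizing_limit r01 mK K0 Kcvx KS Ssup.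
have fS := maximizing_limit_le r01 mK K0 KS Kf_ mf f_f.
have fopt := maximizing_limit_optimal r01 mK K0 Kcvx KS Kf_ Sf_ mf f_f.
have fsup := maximizing_limit_support r01 mK K0 Kcvx KS Kf_ Sf_ mf f_f.
have mfr : measurable_fun setT (fun w => f w `^ r)%R.
  exact: (@measurableT_comp _ _ _ _ _ _ (@powR R ^~ r)).
pose s := fine (\int[mu]_w (f w `^ r)%:E).
have If0 : 0 <= \int[mu]_w (f w `^ r)%:E.
  by apply: integral_ge0 => w _; rewrite lee_fin powR_ge0.
have Is : \int[mu]_w (f w `^ r)%:E = s%:E.
  by rewrite fineK// ge0_fin_numE// (le_lt_trans fS)// ltry.
have s0 : (0 <= s)%R by rewrite -lee_fin -Is.
have sS : (s <= S)%R by rewrite -lee_fin -Is.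
(* If [s = 0], then [f] vanishes almost everywhere, hence so does every [g] in [K], and any density
   will do. *)
move: s0; rewrite le_eqVlt => /predU1P[s0|s0].
  have [h dh] := exists_density mu0; exists h; split => // g Kg.
  have [mh h0 _] := dh.
  have f_ae0 : {ae mu, forall w, f w = 0%R}.
    have : ae_eq mu setT (fun w => (f w `^ r)%:E) (cst 0).
      apply/ae_eq_integral_abs => //; first exact/measurable_EFinP.
      under eq_integral do rewrite gee0_abs ?lee_fin ?powR_ge0//.
      by rewrite Is -s0.
    apply: filterS => w /(_ I)/= [/eqP]; rewrite powR_eq0 (gt_eqF r0)/= andbT.
    by move=> /eqP.
  have g_ae0 : {ae mu, forall w, g w = 0%R}.
    have gf : {ae mu, forall w, ~ ((0 < g w)%R /\ f w = 0%R)}.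
      exists [set w | (0 < g w)%R /\ f w = 0%R]; split.
      - by apply: measurable_gt0_eq0 => //; exact: mK.
      - exact: fsup.
      - by move=> w /= /contrapT.
    apply: filterS2 f_ae0 gf => w fw0 gw; apply/eqP; rewrite eq_le K0// andbT.
    by rewrite leNgt; apply/negP => gw0; apply: gw.
  split.
    rewrite integral_powR_support ?lt_eqF// (ge0_ae_eq_integral (g := cst 0))//.
    - by rewrite integral0.
    - apply/measurable_EFinP; apply: measurable_funM; first exact: mK.
      exact: (@measurableT_comp _ _ _ _ _ _ (@powR R ^~ (1 - r^-1)%R)).
    - by move=> w _; rewrite lee_fin mulr_ge0 ?powR_ge0// K0.
    - by apply: filterS g_ae0 => w -> _; rewrite mul0r.
  apply/negligibleP; first by apply: measurable_gt0_eq0 => //; exact: mK.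
  apply: negligibleS g_ae0 => w /= [gw0 _] gw.
  by rewrite gw ltxx in gw0.
pose h w := (f w `^ r * s^-1)%R.
have hE w : (h w `^ (1 - r^-1) = s `^ (r^-1 - 1) * f w `^ (r - 1))%R.
  rewrite /h powRM ?powR_ge0 ?invr_ge0 ?(ltW s0)// -(powR_inv1 (ltW s0)).
  rewrite -!powRrM [LHS]mulrC; congr (_ `^ _ * _ `^ _)%R; first by ring.
  by field; rewrite gt_eqF.
have h0E w : (h w == 0)%R = (f w == 0)%R.
  by rewrite mulf_eq0 invr_eq0 (gt_eqF s0) orbF powR_eq0 (gt_eqF r0)/= andbT.
have h_ge0 w : (0 <= h w)%R by rewrite mulr_ge0 ?powR_ge0// invr_ge0 ltW.
exists h; split.
  split => //.
  - by apply: measurable_funM.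
  - under eq_integral do rewrite /h mulrC EFinM.
    rewrite ge0_integralZl_EFin ?invr_ge0 ?(ltW s0)//; last 2 first.
    + by move=> w _; rewrite lee_fin powR_ge0.
    + exact/measurable_EFinP.
    by rewrite Is -EFinM mulVf// gt_eqF.
move=> g Kg; split; last first.
  rewrite -(fsup _ Kg); congr (mu _); apply/seteqP.
  by split => w /= [gw0 /eqP hw]; split => //; apply/eqP; move: hw; rewrite h0E.
have -> : [set w | (0 < h w)%R] = [set w | (0 < f w)%R].
  by apply/seteqP; split => w /=; rewrite !lt0r h0E h_ge0 f0.
under eq_integral do rewrite hE mulrCA EFinM.
rewrite ge0_integralZl_EFin ?powR_ge0//; last 3 first.
- exact: measurable_gt0.
- by move=> w _; rewrite lee_fin mulr_ge0 ?powR_ge0// K0.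
- apply: measurable_funTS; apply/measurable_EFinP; apply: measurable_funM; first exact: mK.
  exact: (@measurableT_comp _ _ _ _ _ _ (@powR R ^~ (r - 1)%R)).
apply: (@le_trans _ _ ((s `^ (r^-1 - 1))%:E * S%:E)).
  by apply: lee_wpmul2l; [rewrite lee_fin powR_ge0|exact: fopt].
rewrite -EFinM lee_fin; apply: mulr_ile1 => //.
- by rewrite powR_ge0.
- exact: le_trans (ltW s0) sS.
- suff : (s `^ (r^-1 - 1) <= 1 `^ (r^-1 - 1))%R by rewrite powR1.
  apply: ge0_ler_powR; rewrite ?nnegrE ?(ltW s0)//.
    by rewrite -oppr_le0 opprB ltW.
  exact: le_trans sS S1.
Qed.

End density_change.

(** Strips the outer root from a norm that is not yet known to be finite: at [a = +oo] both sides
    are false. *)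
Lemma poweR_inv_le {R : realType} (a : \bar R) (s M : R) : 0 < s -> 0 <= M ->
  (0 <= a)%E -> (a `^ s^-1 <= M%:E)%E = (a <= (M `^ s)%:E)%E.
Proof.
move=> s0 M0; have sN0 : s != 0 by rewrite gt_eqF.
case: a => [x| |//]; last by rewrite poweRyr ?invr_eq0// !leye_eq.
rewrite lee_fin => x0; rewrite poweR_EFin !lee_fin.
have xE : x = (x `^ s^-1) `^ s by rewrite -powRrM mulVf// powRr1.
rewrite {2}xE; apply/idP/idP => [le1|].
  by apply: ge0_ler_powR; rewrite ?nnegrE ?powR_ge0// ltW.
apply: contraTT; rewrite -!ltNge => lt1.
by apply: gt0_ltr_powR; rewrite ?nnegrE ?powR_ge0.
Qed.

Lemma measurable_LspaceType (R : realType) (d : measure_display)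
    (T : measurableType d) (mu : {measure set T -> \bar R}) (p : \bar R)
    (p1 : (1 <= p)%E) (f : LspaceType mu p1) :
  measurable_fun [set: T] (f : T -> R).
Proof. exact: (@measurable_funPT _ _ _ _ (generic_quotient.repr (f : aeEqMfun _ _))). Qed.

(** * Application to the increments of a map into [L_q], with [r = q / p] *)

Section lspace_family.
Context (R : realType) (X : metricType R) (d : measure_display).
Context (Omega : measurableType d) (mu : {sigma_finite_measure set Omega -> \bar R}).
Variables (p q C : R) (q1 : (1 <= q%:E)%E) (qp : q < p) (C0 : 0 < C).
Variable T : X -> LspaceType mu q1.

Let q_gt0 : 0 < q. Proof. by rewrite (lt_le_trans ltr01)// -lee_fin. Qed.

Let p_gt0 : 0 < p. Proof. exact: lt_trans qp. Qed.

Let r01 : 0 < q / p < 1.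
Proof. by rewrite divr_gt0//= ltr_pdivrMr// mul1r. Qed.

Let incr (x x' : X) w := `|T x w - T x' w| `^ p.

Let cost (x x' : X) := (C * mdist x x') `^ p.

Let measurable_incr x x' : measurable_fun setT (incr x x').
Proof.
apply: (@measurableT_comp _ _ _ _ _ _ (@powR R ^~ p)) => //.
apply: measurableT_comp => //; apply: measurable_funB; exact: measurable_LspaceType.
Qed.

Let incr_ge0 x x' w : 0 <= incr x x' w. Proof. exact: powR_ge0. Qed.

Let cost_ge0 x x' : 0 <= cost x x'. Proof. exact: powR_ge0. Qed.

Let Cmdist_ge0 (x x' : X) : 0 <= C * mdist x x'.
Proof. by rewrite mulr_ge0 ?mdist_ge0// ltW. Qed.

Let costE x x' : cost x x' = C `^ p * mdist x x' `^ p.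
Proof. by rewrite /cost powRM ?mdist_ge0// ltW. Qed.

(** Raising to the power [q] turns [f ^ (1 / p)] into [f ^ (q / p)], and moves [C] inside the power
    as [C ^ p]. *)
Lemma Lnorm_powR_le (f : Omega -> R) (c : R) : (forall w, 0 <= f w) -> 0 <= c ->
  ('N[mu]_(q%:E)[(fun w => (f w `^ p^-1)%:E)] <= (C * c `^ p^-1)%:E)%E <->
  (\int[mu]_w (f w `^ (q / p))%:E <= ((C `^ p * c) `^ (q / p))%:E)%E.
Proof.
move=> f0 c0; rewrite unlock poweR_inv_le ?mulr_ge0 ?powR_ge0 ?(ltW C0)//; last first.
  by apply: integral_ge0 => w _; exact: poweR_ge0.
have -> : (C `^ p * c) `^ (q / p) = (C * c `^ p^-1) `^ q.
  rewrite [q / p]mulrC powRrM powRM ?powR_ge0//; congr ((_ * _) `^ _).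
  by rewrite -powRrM mulfV ?gt_eqF// powRr1// ltW.
under eq_integral.
  by move=> w _; rewrite /= ger0_norm ?powR_ge0// -powRrM mulrC; over.
by [].
Qed.

(** The exponents of [h] add up to [1 - p / q = 1 - 1 / r]. At [h w = 0] both sides are 0, the right
    one by the convention that 0 to a nonzero power is 0. *)
Lemma integrand_powR (h : Omega -> R) x x' w : 0 <= h w ->
  (`|T x w - T x' w| / h w `^ q^-1) `^ p * h w =
  incr x x' w * h w `^ (1 - (q / p)^-1).
Proof.
rewrite le_eqVlt => /predU1P[<-|h0].
  rewrite mulr0 powR0 ?mulr0// lt_eqF// subr_lt0 invf_gt1; by case/andP: r01.
have hN0 : h w != 0 by rewrite gt_eqF.
rewrite powRM ?invr_ge0 ?powR_ge0// -/(incr x x' w) -mulrA; congr (_ * _).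
rewrite -powRN -powRrM powRB ?hN0 ?implybT// powRr1 ?(ltW h0)// mulrC.
by rewrite invfM invrK mulNr powRN.
Qed.

Lemma integral_integrand_powR (h : Omega -> R) x x' : (forall w, 0 <= h w) ->
  (\int[mu]_(w in [set w | (0 < h w)%R])
     ((`|T x w - T x' w| / h w `^ q^-1) `^ p * h w)%:E =
   \int[mu]_(w in [set w | (0 < h w)%R])
     (incr x x' w * h w `^ (1 - (q / p)^-1))%:E)%E.
Proof. by move=> h0; apply: eq_integral => w _; rewrite integrand_powR. Qed.

(** The weighted integral in [integral_powR_le_density] is linear in [f], so for [f] the sum of the
    [p]-th powers its bound can be checked term by term. *)
Lemma density_imp_sum_le (h : Omega -> R) : density_function mu h ->
  (forall x x' : X,
    ((\int[mu]_(w in [set w | (0 < h w)%R])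
        ((`|T x w - T x' w| / h w `^ q^-1) `^ p * h w)%:E) `^ p^-1
     <= (C * mdist x x')%:E)%E) ->
  (forall x x' : X,
    mu [set w | 0 < `|T x w - T x' w| /\ h w = 0] = 0%E) ->
  forall (n : nat) (x x' : 'I_n -> X) (lambda : 'I_n -> R),
    (forall j, 0 <= lambda j) ->
    ('N[mu]_(q%:E)[(fun w =>
        ((\sum_(j < n) lambda j * `|T (x j) w - T (x' j) w| `^ p)
           `^ p^-1)%:E)]
     <= (C * (\sum_(j < n) lambda j * mdist (x j) (x' j) `^ p)
               `^ p^-1)%:E)%E.
Proof.
move=> dh hle hnull n x x' lambda l0; have [mh h0 _] := dh.
have rV : (1 - (q / p)^-1) != 0.
  by rewrite lt_eqF// subr_lt0 invf_gt1; case/andP: r01.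
apply/Lnorm_powR_le.
- by move=> w; apply: sumr_ge0 => j _; rewrite mulr_ge0 ?powR_ge0.
- by apply: sumr_ge0 => j _; rewrite mulr_ge0 ?powR_ge0.
apply: (integral_powR_le_density (h := h)) => //.
- by rewrite mulr_ge0 ?powR_ge0// sumr_ge0// => j _; rewrite mulr_ge0 ?powR_ge0.
- apply: measurable_sum => j; apply: measurable_funM => //.
  exact: measurable_incr.
- by move=> w; apply: sumr_ge0 => j _; rewrite mulr_ge0 ?powR_ge0.
- have mnull j : measurable [set w | 0 < `|T (x j) w - T (x' j) w| /\ h w = 0].
    apply: measurable_gt0_eq0 => //; apply: measurableT_comp => //.
    by apply: measurable_funB; exact: measurable_LspaceType.
  (* There are finitely many pairs, so their exceptional null sets can be discarded together. *)
  have : {ae mu, forall w, forall j : 'I_n,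
      ~ (0 < `|T (x j) w - T (x' j) w| /\ h w = 0)}.
    apply: filter_forall => j.
    exists [set w | 0 < `|T (x j) w - T (x' j) w| /\ h w = 0].
    by split; [exact: mnull|exact: hnull|move=> w /= /contrapT].
  apply: filterS => w nw hw; apply: big1 => j _.
  have [->|dN0] := eqVneq `|T (x j) w - T (x' j) w| 0.
    by rewrite powR0 ?mulr0// gt_eqF.
  by exfalso; apply: (nw j); split => //; rewrite lt0r dN0/=.
rewrite integral_powR_support//.
under eq_integral do rewrite mulr_suml -sumEFin.
rewrite ge0_integral_sum//; last 2 first.
- move=> j; apply/measurable_EFinP; apply: measurable_funM.
    by apply: measurable_funM => //; exact: measurable_incr.
  exact: (@measurableT_comp _ _ _ _ _ _ (@powR R ^~ (1 - (q / p)^-1))).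
- by move=> j w _; rewrite lee_fin !mulr_ge0 ?powR_ge0.
rewrite mulr_sumr -sumEFin; apply: lee_sum => j _.
under eq_integral do rewrite -mulrA EFinM.
rewrite ge0_integralZl_EFin//; last 2 first.
- by move=> w _; rewrite lee_fin mulr_ge0 ?powR_ge0.
- apply/measurable_EFinP; apply: measurable_funM; first exact: measurable_incr.
  exact: (@measurableT_comp _ _ _ _ _ _ (@powR R ^~ (1 - (q / p)^-1))).
rewrite mulrCA -costE EFinM; apply: lee_wpmul2l; first by rewrite lee_fin.
have := hle (x j) (x' j).
rewrite poweR_inv_le//; last first.
  by apply: integral_ge0 => w _; rewrite lee_fin mulr_ge0 ?powR_ge0.
by rewrite integral_integrand_powR// integral_powR_support.
Qed.

Let combination (s : seq (R * (X * X))) w :=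
  \sum_(t <- s) t.1 * incr t.2.1 t.2.2 w.

(** With lists, a convex combination is the concatenation of two rescaled lists, and the empty list
    makes the set nonempty even when [X] is empty. *)
Let unit_combinations : set (Omega -> R) :=
  [set f | exists s : seq (R * (X * X)), [/\ all (fun t => 0 <= t.1) s,
    \sum_(t <- s) t.1 * cost t.2.1 t.2.2 <= 1 & f = combination s]].

(** [maurey_density] is applied to [unit_combinations]; its conclusion is then read on the
    normalized increments [incr x x' / cost x x']. *)
Lemma sum_le_imp_density : mu [set: Omega] != 0%E ->
  (forall (n : nat) (x x' : 'I_n -> X) (lambda : 'I_n -> R),
    (0 < n)%N ->
    (forall j, 0 <= lambda j) ->
    ('N[mu]_(q%:E)[(fun w =>
        ((\sum_(j < n) lambda j * `|T (x j) w - T (x' j) w| `^ p)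
           `^ p^-1)%:E)]
     <= (C * (\sum_(j < n) lambda j * mdist (x j) (x' j) `^ p)
               `^ p^-1)%:E)%E) ->
  exists h : Omega -> R,
    [/\ density_function mu h,
        (forall x x' : X,
          ((\int[mu]_(w in [set w | (0 < h w)%R])
              ((`|T x w - T x' w| / h w `^ q^-1) `^ p * h w)%:E) `^ p^-1
           <= (C * mdist x x')%:E)%E) &
        (forall x x' : X,
          mu [set w | 0 < `|T x w - T x' w| /\ h w = 0] = 0%E)].
Proof.
move=> mu0 sumle.
have scale_sum (G : R * (X * X) -> R) (a : R) s :
    (forall t, G (a * t.1, t.2) = a * G t) ->
    \sum_(t <- [seq (a * t.1, t.2) | t <- s]) G t = a * \sum_(t <- s) G t.
  by move=> Ga; rewrite big_map mulr_sumr; apply: eq_bigr => t _; exact: Ga.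
have [|||||h [dh hK]] := @maurey_density _ _ R mu (q / p) unit_combinations mu0 r01.
- by move=> _ [s [_ _ ->]]; apply: measurable_sum => t; exact: measurable_funM.
- move=> _ [s [/allP s0 _ ->]] w; rewrite /combination big_seq.
  by apply: sumr_ge0 => t ts; rewrite mulr_ge0// s0.
- move=> _ _ t [s1 [s10 s11 ->]] [s2 [s20 s21 ->]] /andP[t0 t1].
  exists ([seq (t * u.1, u.2) | u <- s1] ++ [seq ((1 - t) * u.1, u.2) | u <- s2]).
  have t1' : 0 <= 1 - t by rewrite subr_ge0.
  split.
  + rewrite all_cat !all_map; apply/andP; split.
      by apply: sub_all s10 => u u0 /=; rewrite mulr_ge0.
    by apply: sub_all s20 => u u0 /=; rewrite mulr_ge0.
  + rewrite big_cat !scale_sum//=; try by move=> u; rewrite mulrA.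
    have := ler_wpM2l t0 s11; have := ler_wpM2l t1' s21; lra.
  + apply/funext => w; rewrite /combination big_cat !scale_sum//=;
      by move=> u; rewrite mulrA.
- by exists (combination [::]), [::]; split => //; rewrite big_nil.
- move=> _ [s [/allP s0 s1 ->]].
  (* The hypothesis speaks of sums with at least one term, so the empty list is treated apart. *)
  have [->|sN0] := eqVneq s [::].
    rewrite integral0_eq// => w _; rewrite /combination big_nil powR0//.
    by rewrite gt_eqF//; case/andP: r01.
  have ssize : (0 < size s)%N by rewrite lt0n size_eq0.
  pose tn := tnth (in_tuple s).
  have lam0 j : 0 <= (tn j).1 by apply: s0; exact: mem_tnth.
  have := sumle (size s) (fun j => (tn j).2.1) (fun j => (tn j).2.2)
    (fun j => (tn j).1) ssize lam0.
  move/Lnorm_powR_le => /(_ _ _)/wrap[||].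
  + by move=> w; apply: sumr_ge0 => j _; rewrite mulr_ge0.
  + by apply: sumr_ge0 => j _; rewrite mulr_ge0 ?powR_ge0.
  have -> : (fun w => (combination s w `^ (q / p))%:E) =
    (fun w => ((\sum_(j < size s) (tn j).1 * `|T (tn j).2.1 w - T (tn j).2.2 w| `^ p)
       `^ (q / p))%:E).
    by apply/funext => w; rewrite /combination big_tnth.
  move=> /le_trans; apply; rewrite lee_fin.
  have -> : C `^ p * (\sum_(j < size s) (tn j).1 * mdist (tn j).2.1 (tn j).2.2 `^ p)
      = \sum_(t <- s) t.1 * cost t.2.1 t.2.2.
    rewrite mulr_sumr [RHS]big_tnth; apply: eq_bigr => j _.
    by rewrite costE mulrCA.
  suff : (\sum_(t <- s) t.1 * cost t.2.1 t.2.2) `^ (q / p) <= 1 `^ (q / p).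
    by rewrite powR1.
  apply: ge0_ler_powR => //; rewrite ?nnegrE//.
    by rewrite ltW//; case/andP: r01.
  by rewrite big_seq; apply: sumr_ge0 => t ts; rewrite mulr_ge0// s0.
have [mh h0 _] := dh.
have rV : (1 - (q / p)^-1) != 0.
  by rewrite lt_eqF// subr_lt0 invf_gt1; case/andP: r01.
have mint x x' : measurable_fun setT
    (fun w => (incr x x' w * h w `^ (1 - (q / p)^-1))%:E).
  apply/measurable_EFinP; apply: measurable_funM; first exact: measurable_incr.
  exact: (@measurableT_comp _ _ _ _ _ _ (@powR R ^~ (1 - (q / p)^-1))).
have main x x' :
    (\int[mu]_(w in [set w | (0 < h w)%R])
       (incr x x' w * h w `^ (1 - (q / p)^-1))%:E <= (cost x x')%:E)%E /\
    mu [set w | 0 < `|T x w - T x' w| /\ h w = 0] = 0%E.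
  (* For [x = x'] the cost is 0 and cannot be divided by, but the increment is 0 as well. Distinct
     points have positive cost because [X] is a metric space. *)
  have [xx'|xx'] := eqVneq x x'.
    rewrite xx'; split.
      rewrite integral0_eq ?lee_fin// => w _.
      by rewrite /incr subrr normr0 powR0 ?mul0r// gt_eqF.
    rewrite [X in mu X](_ : _ = set0) ?measure0//.
    by rewrite -subset0 => w /= [] ; rewrite subrr normr0 ltxx.
  have cost0 : 0 < cost x x' by rewrite powR_gt0// mulr_gt0// mdist_gt0.
  have [] := hK (combination [:: ((cost x x')^-1, (x, x'))]).
    exists [:: ((cost x x')^-1, (x, x'))]; split => //=.
      by rewrite invr_ge0 cost_ge0.
    by rewrite big_seq1/= mulVf// gt_eqF.
  have cE w : combination [:: ((cost x x')^-1, (x, x'))] w = (cost x x')^-1 * incr x x' w.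
    by rewrite /combination big_seq1.
  rewrite !integral_powR_support//.
  under eq_integral do rewrite cE -mulrA EFinM.
  rewrite ge0_integralZl_EFin//; last 2 first.
  + by move=> w _; rewrite lee_fin mulr_ge0 ?powR_ge0.
  + by rewrite invr_ge0.
  move=> le1 null; split.
    have := lee_wpmul2l (ltW (cost0 : (0 < (cost x x')%:E)%E)) le1.
    by rewrite mule1 muleA -EFinM mulfV ?gt_eqF// mul1e.
  rewrite -null; congr (mu _); apply/seteqP; split => w /= [d0 hw]; split => //.
    by rewrite cE mulr_gt0 ?invr_gt0// powR_gt0.
  have : 0 < incr x x' w by move: d0; rewrite cE pmulr_rgt0// invr_gt0.
  by rewrite /incr lt0r powR_eq0 (gt_eqF p_gt0) andbT normr_gt0 normr_eq0 => /andP[].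
exists h; split => // x x'; last by have [] := main x x'.
rewrite poweR_inv_le//; last first.
  by apply: integral_ge0 => w _; rewrite lee_fin mulr_ge0 ?powR_ge0.
by rewrite integral_integrand_powR//; have [] := main x x'.
Qed.

End lspace_family.

Unset Implicit Arguments.
Set Strict Implicit.

Theorem theorem3p1 (R : realType) (X : metricType R)
    (d : measure_display) (Omega : measurableType d)
    (mu : {sigma_finite_measure set Omega -> \bar R})
    (* a nonzero measure: the zero measure has no density function *)
    (mu_neq0 : mu [set: Omega] != 0%E)
    (p q : R) (q1 : (1 <= q%:E)%E) (qp : q < p)
    (T : X -> LspaceType mu q1) (T_lip : Lspace_lipschitz T)
    (C : R) (C0 : 0 < C) :
  (exists h : Omega -> R,
    [/\ density_function mu h,
        (forall x x' : X,
          ((\int[mu]_(w in [set w | (0 < h w)%R])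
              ((`|T x w - T x' w| / h w `^ q^-1) `^ p * h w)%:E) `^ p^-1
           <= (C * mdist x x')%:E)%E) &
        (forall x x' : X,
          mu [set w | 0 < `|T x w - T x' w| /\ h w = 0] = 0%E)])
  <->
  (forall (n : nat) (x x' : 'I_n -> X) (lambda : 'I_n -> R),
    (0 < n)%N ->
    (forall j, 0 <= lambda j) ->
    ('N[mu]_(q%:E)[(fun w =>
        ((\sum_(j < n) lambda j * `|T (x j) w - T (x' j) w| `^ p)
           `^ p^-1)%:E)]
     <= (C * (\sum_(j < n) lambda j * mdist (x j) (x' j) `^ p)
               `^ p^-1)%:E)%E).
Proof.
split=> [[h [dh hle hnull]] n x x' lambda _ l0|sumle].
  exact: (density_imp_sum_le qp C0 dh).
exact: (sum_le_imp_density qp C0 mu_neq0).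
Qed.
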